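(* Consider a radial weight $e^{\psi(x)}:=e^{\delta(|x|)}$ in $\mathbb{R}^{n+1}$ such that $\delta:[0,+\infty)\to\mathbb{R}$ is a $C^1$ non-increasing function with $\delta'(0)=0$. Let $\Sigma$ be a two-sided, connected, $\psi$-parabolic and $\psi$-minimal hypersurface contained in a closed half-space $F$ of $\mathbb{R}^{n+1}$ with $0\in\partial F$. If $\langle\eta,\nu\rangle\geq 0$ along $\partial\Sigma$, where $\eta$ is the unit normal to $\partial F$ pointing outside $F$ and $\nu$ is the inner unit conormal of $\Sigma$ along $\partial\Sigma$, then $\Sigma$ is contained in a hyperplane parallel to $\partial F$. Moreover, if $\psi$ is non-constant on $\Sigma$, then $\Sigma\subseteq\partial F$.
   Context: For a two-sided smooth hypersurface $\Sigma\subset\mathbb{R}^{n+1}$ (possibly with smooth boundary $\partial\Sigma$) with unit normal $N$, the $\psi$-mean curvature is $H_\psi:=-\operatorname{div}_\Sigma N-\langle\nabla\psi,N\rangle$, and $\Sigma$ is $\psi$-minimal if $H_\psi=0$ on $\Sigma$. On $\Sigma$ with the induced metric, $\Delta_{\Sigma,\psi}u:=\Delta_\Sigma u+\langle\nabla_\Sigma\psi,\nabla_\Sigma u\rangle$. $\Sigma$ is $\psi$-parabolic if every $u\in C^2(\Sigma)$ that is bounded from above, satisfies $\Delta_{\Sigma,\psi}u\geq 0$ on $\Sigma\setminus\partial\Sigma$ and $\partial u/\partial\nu\geq 0$ along $\partial\Sigma$ is constant. *)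

(* Defs.v *)
From HB Require Import structures.
From mathcomp Require Import all_boot all_order all_algebra.
From mathcomp Require Import all_classical all_reals all_analysis.

Set Implicit Arguments.
Unset Strict Implicit.
Unset Printing Implicit Defensive.

Import Order.TTheory GRing.Theory Num.Theory.
Import numFieldNormedType.Exports.

Local Open Scope classical_set_scope.
Local Open Scope ring_scope.

(* The library norm on 'rV[R]_n.+1 is the sup norm, so the Euclidean structure is
   defined here; both give the same topology and the same notion of
   differentiability. *)

Section Euclidean.
Variables (R : realType) (n : nat).
Local Notation E := 'rV[R]_n.+1.

Definition dot (u v : E) : R := \sum_i u 0 i * v 0 i.
Definition enorm (u : E) : R := Num.sqrt (dot u u).

Definition grad (f : E -> R) (x : E) : E := \row_i 'D_(delta_mx 0 i) f x.

(* The closed half-space {<x, eta> <= c}; for |eta| = 1 its boundary is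
   [hyperplane eta c], with unit normal eta pointing out of the half-space. *)
Definition half_space (eta : E) (c : R) : set E := [set x | dot x eta <= c].
Definition hyperplane (eta : E) (c : R) : set E := [set x | dot x eta = c].

End Euclidean.

Section Regularity.
Variables (R : realType) (n : nat) (W : normedModType R).
Local Notation E := 'rV[R]_n.+1.

(* f is of class C^k on U; meant for open U, where 'D_v f only depends on the
   restriction of f to U. *)
Fixpoint Ck (k : nat) (U : set E) (f : E -> W) : Prop :=
  match k with
  | 0 => forall x, U x -> {for x, continuous f}
  | k'.+1 => (forall x, U x -> differentiable f x) /\
             (forall v : E, Ck k' U (fun x => 'D_v f x))
  end.

Definition smooth (U : set E) (f : E -> W) := forall k, Ck k U f.

(* The C^k extensions of u|_Sigma to a neighbourhood of p in R^{n+1}.  A function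
   on Sigma is represented by a function on R^{n+1} of which only the values on
   Sigma matter; its regularity and its derivatives on Sigma, up to the boundary,
   are those of its local extensions. *)
Definition local_ext (k : nat) (Sigma : set E) (u : E -> W) (p : E) :
    set (E -> W) :=
  [set v | exists U : set E,
     [/\ open U, U p, Ck k U v & forall q, (U `&` Sigma) q -> v q = u q]].

Definition Ck_on (k : nat) (Sigma : set E) (u : E -> W) : Prop :=
  forall p, Sigma p -> exists v, local_ext k Sigma u p v.

Definition smooth_on (Sigma : set E) (u : E -> W) := forall k, Ck_on k Sigma u.

(* A chosen local C^1 extension (u itself if there is none).  On a hypersurface
   the tangential derivatives at p do not depend on the choice. *)
Definition ext (Sigma : set E) (u : E -> W) (p : E) : E -> W :=
  xget u (local_ext 1 Sigma u p).

End Regularity.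

Section Hypersurface.
Variables (R : realType) (n : nat).
Local Notation E := 'rV[R]_n.+1.
Implicit Types (Sigma : set E) (p : E) (Phi Psi N nu X : E -> E) (u psi : E -> R).

Definition diffeo (U V : set E) Phi Psi : Prop :=
  [/\ open U /\ open V,
      smooth U Phi /\ smooth V Psi,
      forall x, U x -> V (Phi x) /\ Psi (Phi x) = x &
      forall y, V y -> U (Psi y) /\ Phi (Psi y) = y].

(* Phi is a diffeomorphism of a neighbourhood of p that flattens Sigma to
   {y_last = 0}. *)
Definition interior_chart Sigma p Phi : Prop :=
  exists U V Psi,
    [/\ U p, diffeo U V Phi Psi &
        forall x, U x -> (Sigma x <-> Phi x 0 ord_max = 0)].

(* Phi is a diffeomorphism of a neighbourhood of p that flattens Sigma to
   {y_last = 0, y_i >= 0} and sends p to the edge {y_last = 0, y_i = 0}. *)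
Definition boundary_chart Sigma p (i : 'I_n.+1) Phi : Prop :=
  i != ord_max /\
  exists U V Psi,
    [/\ U p, Sigma p /\ Phi p 0 i = 0, diffeo U V Phi Psi &
        forall x, U x ->
          (Sigma x <-> Phi x 0 ord_max = 0 /\ 0 <= Phi x 0 i)].

Definition hypersurface Sigma : Prop :=
  forall p, Sigma p ->
    (exists Phi, interior_chart Sigma p Phi) \/
    (exists i Phi, boundary_chart Sigma p i Phi).

Definition bdry Sigma : set E :=
  [set p | exists i Phi, boundary_chart Sigma p i Phi].

Definition tangent_space Sigma p : set E :=
  [set v | exists Phi,
     (interior_chart Sigma p Phi \/ exists i, boundary_chart Sigma p i Phi) /\
     ('D_v Phi p) 0 ord_max = 0].

(* Sigma is two-sided when such an N exists. *)
Definition unit_normal Sigma N : Prop :=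
  smooth_on Sigma N /\
  forall p, Sigma p ->
    enorm (N p) = 1 /\ (forall v, tangent_space Sigma p v -> dot (N p) v = 0).

(* Along the boundary, nu is the unit vector tangent to Sigma, orthogonal to the
   boundary and pointing into Sigma. *)
Definition inner_conormal Sigma nu : Prop :=
  forall p, bdry Sigma p ->
    exists i Phi,
      [/\ boundary_chart Sigma p i Phi,
          enorm (nu p) = 1,
          ('D_(nu p) Phi p) 0 ord_max = 0,
          0 < ('D_(nu p) Phi p) 0 i &
          forall v, ('D_v Phi p) 0 ord_max = 0 -> ('D_v Phi p) 0 i = 0 ->
            dot (nu p) v = 0].

(* tproj, gradS, divS and everything below only depend on N through the
   tangent hyperplane, except for wmean_curv, which changes sign with N. *)
Definition tproj N p (v : E) : E := v - dot v (N p) *: N p.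

Definition gradS Sigma N u p : E := tproj N p (grad (ext Sigma u p) p).

(* The sum of <D_e X, e> over an orthonormal basis e of the tangent space at p,
   computed as the trace over an orthonormal basis of R^{n+1} containing N p,
   minus the term of N p. *)
Definition divS Sigma N X p : R :=
  let Y := ext Sigma X p in \tr ('J Y p) - dot ('D_(N p) Y p) (N p).

Definition lapS Sigma N u p : R := divS Sigma N (gradS Sigma N u) p.

Definition wlapS Sigma N psi u p : R :=
  lapS Sigma N u p + dot (gradS Sigma N psi p) (gradS Sigma N u p).

Definition wmean_curv Sigma N psi p : R :=
  - divS Sigma N N p - dot (grad psi p) (N p).

Definition wminimal Sigma N psi : Prop :=
  forall p, Sigma p -> wmean_curv Sigma N psi p = 0.

Definition constant_on Sigma u : Prop :=
  exists c : R, forall p, Sigma p -> u p = c.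

Definition wparabolic Sigma N nu psi : Prop :=
  forall u,
    Ck_on 2 Sigma u ->
    (exists M : R, forall p, Sigma p -> u p <= M) ->
    (forall p, (Sigma `\` bdry Sigma) p -> 0 <= wlapS Sigma N psi u p) ->
    (forall p, bdry Sigma p -> 0 <= dot (gradS Sigma N u p) (nu p)) ->
    constant_on Sigma u.

End Hypersurface.

(* delta is C^1 on [0, +oo[ with derivative ddelta (one-sided at 0); the values
   at negative arguments are irrelevant. *)
Definition C1_halfline (R : realType) (delta ddelta : R -> R) : Prop :=
  [/\ forall t : R, 0 < t -> is_derive t 1 delta (ddelta t),
      h^-1 * (delta h - delta 0) @[h --> (0 : R)^'+] --> ddelta 0 &
      {within [set t : R | 0 <= t], continuous ddelta}].

Definition nonincreasing_halfline (R : realType) (delta : R -> R) : Prop :=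
  forall s t : R, 0 <= s -> s <= t -> delta t <= delta s.

Definition radial (R : realType) (n : nat) (delta : R -> R) (x : 'rV[R]_n.+1) : R :=
  delta (enorm x).

(* Main.v *)
(* The height u = <x, eta> is bounded above on Sigma, its boundary derivative is
   <eta, nu> >= 0, and minimality turns its weighted Laplacian into
   <grad psi, eta> = delta'(|x|) / |x| * u >= 0; hence parabolicity makes u a
   constant d.  If d <> 0, the weighted Laplacian of the constant u vanishes, so
   delta' = 0 on the interval |Sigma| and psi is constant on Sigma.

   The tangential operators are defined through arbitrary local C^1 extensions.
   What makes them computable is that a differentiable function vanishing on
   Sigma near p has zero derivative along every v orthogonal to N p, because a
   curve in Sigma with velocity v or - v starts at p (in a chart, a segment). *)

Require Import Defs.
From HB Require Import structures.
From mathcomp Require Import all_boot all_order all_algebra.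
From mathcomp Require Import all_classical all_reals all_analysis.
From mathcomp Require Import ring.

Import Order.TTheory GRing.Theory Num.Theory.
Import numFieldNormedType.Exports.

Local Open Scope classical_set_scope.
Local Open Scope ring_scope.

(** * Euclidean inner product and norm *)

Section Dot.
Context {R : realType} {n : nat}.
Local Notation E := 'rV[R]_n.+1.
Implicit Types (u v w e : E) (k : R).

Lemma dotC u v : dot u v = dot v u.
Proof. by apply: eq_bigr => i _; rewrite mulrC. Qed.

Lemma dotE u v : dot u v = (u *m v^T) 0 0.
Proof. by rewrite mxE; apply: eq_bigr => i _; rewrite !mxE. Qed.

Lemma mul_tr_dot u v : u *m v^T = (dot u v)%:M.
Proof. by rewrite [LHS]mx11_scalar -dotE. Qed.

Lemma dotDl u v w : dot (u + v) w = dot u w + dot v w.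
Proof. by rewrite !dotE mulmxDl mxE. Qed.

Lemma dotZl k u w : dot (k *: u) w = k * dot u w.
Proof. by rewrite !dotE -scalemxAl mxE. Qed.

Lemma dotZr k u w : dot w (k *: u) = k * dot w u.
Proof. by rewrite dotC dotZl dotC. Qed.

Lemma dotNl u w : dot (- u) w = - dot u w.
Proof. by rewrite -scaleN1r dotZl mulN1r. Qed.

Lemma dotBl u v w : dot (u - v) w = dot u w - dot v w.
Proof. by rewrite dotDl dotNl. Qed.

Lemma dotBr u v w : dot w (u - v) = dot w u - dot w v.
Proof. by rewrite dotC dotBl !(dotC w). Qed.

Lemma dot0l u : dot 0 u = 0.
Proof. by rewrite -(scale0r 0) dotZl mul0r. Qed.

Lemma dot0r u : dot u 0 = 0.
Proof. by rewrite dotC dot0l. Qed.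

Lemma dot_delta u i : dot u (delta_mx 0 i) = u 0 i.
Proof. by rewrite dotE trmx_delta -colE mxE. Qed.

Lemma dot_ge0 u : 0 <= dot u u.
Proof. by apply: sumr_ge0 => i _; rewrite -expr2 sqr_ge0. Qed.

Lemma dot_eq0 u : dot u u = 0 -> u = 0.
Proof.
move=> u0; apply/rowP => i; rewrite mxE.
have /eqP : u 0 i * u 0 i = 0.
  move/eqP: u0; rewrite psumr_eq0 => [/allP/(_ i)|j _]; last by rewrite -expr2 sqr_ge0.
  by rewrite mem_index_enum => /(_ isT) /eqP.
by rewrite mulf_eq0 orbb => /eqP.
Qed.

Lemma enorm_ge0 u : 0 <= enorm u.
Proof. exact: sqrtr_ge0. Qed.

Lemma enorm_sqr u : enorm u ^+ 2 = dot u u.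
Proof. by rewrite sqr_sqrtr// dot_ge0. Qed.

Lemma enorm_eq0 u : enorm u = 0 -> u = 0.
Proof. by move=> u0; apply: dot_eq0; rewrite -enorm_sqr u0 expr0n. Qed.

Lemma enorm1_dot u : enorm u = 1 -> dot u u = 1.
Proof. by move=> u1; rewrite -enorm_sqr u1 expr1n. Qed.

(** The component of [u] orthogonal to [g] is, by hypothesis, orthogonal to [u] as well, hence to
    itself, so it vanishes. Thus [u] is a multiple of [g], with nonzero factor because [u != 0]. *)
Lemma perp_kernel g u v : u != 0 ->
  (forall w, dot g w = 0 -> dot u w = 0) -> dot u v = 0 -> dot g v = 0.
Proof.
move=> u0 gu uv.
have [->|g0] := eqVneq g 0; first by rewrite dot0l.
have gg : dot g g != 0 by apply: contra_neq g0 => /dot_eq0.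
pose k := dot g u / dot g g.
have gw : dot g (u - k *: g) = 0 by rewrite dotBr dotZr divfK// subrr.
have /dot_eq0/eqP : dot (u - k *: g) (u - k *: g) = 0.
  by rewrite dotBl (gu _ gw) dotZl gw mulr0 subr0.
rewrite subr_eq0 => /eqP uE.
move: uv; rewrite uE dotZl => /eqP; rewrite mulf_eq0 => /orP[/eqP k0|/eqP//].
by move: u0; rewrite uE k0 scale0r eqxx.
Qed.

End Dot.

(** * Coordinatewise differentiation and product rules *)

Section Calculus.
Context {R : realType} {V : normedModType R} {n : nat}.
Local Notation E := 'rV[R]_n.+1.

Lemma differentiable_rowP (f : V -> E) x :
  differentiable f x <-> forall i, differentiable (fun y => f y 0 i) x.
Proof.
split=> [df i|df].
  exact: (@differentiable_comp _ _ _ _ f (fun M : E => M 0 i) x df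
           (differentiable_coord (f x) 0 i)).
have -> : f = \sum_i (fun y => f y 0 i *: delta_mx 0 i).
  by apply/funext => y; rewrite fct_sumE [LHS]row_sum_delta.
by apply: differentiable_sum => i; apply: differentiableZl.
Qed.

Lemma derive_coord (f : V -> E) x v i : differentiable f x ->
  ('D_v f x) 0 i = 'D_v (fun y => f y 0 i) x.
Proof. by move=> df; rewrite derive_mx ?mxE//; exact: diff_derivable. Qed.

Lemma is_derive_dot (f g : V -> E) x v :
  differentiable f x -> differentiable g x ->
  differentiable (fun y => dot (f y) (g y)) x /\
  'D_v (fun y => dot (f y) (g y)) x = dot ('D_v f x) (g x) + dot (f x) ('D_v g x).
Proof.
move=> df dg; have fi := (differentiable_rowP f x).1 df.
have gi := (differentiable_rowP g x).1 dg.
have -> : (fun y => dot (f y) (g y)) = \sum_i ((fun y => f y 0 i) * (fun y => g y 0 i)).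
  by apply/funext => y; rewrite fct_sumE.
split; first by apply: differentiable_sum => i; exact: differentiableM.
rewrite derive_sum; last first.
  by move=> i; apply: derivableM; exact: diff_derivable.
rewrite -big_split; apply: eq_bigr => i _.
rewrite deriveM; [|by apply: diff_derivable..].
by rewrite !derive_coord// addrC mulrC.
Qed.

Lemma is_derive_scale (k : V -> R) (f : V -> E) x v :
  differentiable k x -> differentiable f x ->
  differentiable (fun y => k y *: f y) x /\
  'D_v (fun y => k y *: f y) x = 'D_v k x *: f x + k x *: 'D_v f x.
Proof.
move=> dk df; have fi := (differentiable_rowP f x).1 df.
have kfi i : (fun y => (k y *: f y) 0 i) = k * (fun y => f y 0 i).
  by apply/funext => y; rewrite mxE.
have dkf : differentiable (fun y => k y *: f y) x.
  by apply/differentiable_rowP => i; rewrite kfi; exact: differentiableM.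
split=> //; apply/rowP => i.
rewrite derive_coord// kfi deriveM; [|exact: diff_derivable..].
by rewrite !mxE derive_coord// addrC; congr (_ + _); exact: mulrC.
Qed.

End Calculus.

(** Once the derivative exists, it equals the limit of the right difference quotients. One-sided
    information is all there is for a curve that starts at a boundary point. *)
Lemma derive_eq0_right (R : realType) (W : normedModType R) (f : R -> W) :
  derivable f 0 1 -> f 0 = 0 -> (\forall t \near 0^'+, f t = 0) -> 'D_1 f 0 = 0.
Proof.
move=> df f0 fpos; rewrite /derive cvg_at_rightE//.
apply: lim_near_cst => //; near=> t.
by rewrite /= f0 subr0 addr0 [t *: 1]mulr1 (near fpos t) ?scaler0.
Unshelve. all: by end_near. Qed.

Lemma derive_line (R : numFieldType) (V : normedModType R) (a v : V) :
  'D_1 (fun t : R => a + t *: v) 0 = v.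
Proof.
apply: lim_near_cst => //; near=> t.
rewrite /= [t *: 1]mulr1 addr0 scale0r addr0 [a + _]addrC addrK scalerA mulVf ?scale1r//.
by near: t; exact: nbhs_dnbhs_neq.
Unshelve. all: by end_near. Qed.

(** * Charts and curves inside a hypersurface *)

Section Charts.
Context {R : realType} {n : nat}.
Local Notation E := 'rV[R]_n.+1.
Implicit Types (Sigma U V : set E) (p v w : E) (Phi Psi : E -> E).

Lemma smooth_differentiable (W : normedModType R) U (f : E -> W) p :
  smooth U f -> U p -> differentiable f p.
Proof. by move=> /(_ 1%N) [df _]; exact: df. Qed.

Lemma diffeo_diffK U V Phi Psi p v : diffeo U V Phi Psi -> U p ->
  'd Psi (Phi p) ('d Phi p v) = v.
Proof.
move=> [[oU oV] [sPhi sPsi] UV VU] Up.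
have dPhi := smooth_differentiable _ _ _ _ sPhi Up.
have dPsi := smooth_differentiable _ _ _ _ sPsi (UV p Up).1.
rewrite -[LHS]/(('d Psi (Phi p) \o 'd Phi p) v) -diff_comp//.
rewrite -deriveE; last exact: differentiable_comp.
rewrite (@near_eq_derive _ _ _ _ id) ?derive_id//.
by apply: filterS (open_nbhs_nbhs (conj oU Up)) => q /UV [].
Qed.

(** The disjunction occurring in [tangent_space], so that interior and boundary points are handled
    together: both kinds of chart flatten [Sigma] into the zero set of the last coordinate. *)
Definition flat_chart Sigma p Phi : Prop :=
  interior_chart Sigma p Phi \/ exists i, boundary_chart Sigma p i Phi.

Lemma flat_chart_diff Sigma p Phi : flat_chart Sigma p Phi ->
  exists U V Psi, U p /\ diffeo U V Phi Psi.
Proof.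
by move=> [[U [V [Psi []]]]|[i [_ [U [V [Psi []]]]]]]; exists U, V, Psi.
Qed.

Lemma flat_chart_differentiable Sigma p Phi : flat_chart Sigma p Phi ->
  differentiable Phi p.
Proof.
move=> /flat_chart_diff[U [V [Psi [Up [_ [sPhi _] _ _]]]]].
exact: smooth_differentiable sPhi Up.
Qed.

(* Near a boundary point the curve in direction v may leave the hypersurface, in
   which case the one in direction - v stays in it; hence the factor s. *)
Lemma flat_chart_curve Sigma p Phi v : Sigma p -> flat_chart Sigma p Phi ->
  ('D_v Phi p) 0 ord_max = 0 ->
  exists (gamma : R -> E) (s : R),
    [/\ s != 0, differentiable gamma 0, gamma 0 = p, 'D_1 gamma 0 = s *: v &
        \forall t \near 0^'+, Sigma (gamma t)].
Proof.
move=> Sp chart vlast.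
have dPhi := flat_chart_differentiable _ _ _ chart.
(* The curve is the image under [Psi] of a segment from [Phi p] in direction [s *: 'D_v Phi p]. The
   two premises inside the limit hold for small [t] because [V] is open; only the sign [s] and the
   membership in [Sigma] depend on the kind of chart. *)
suff [U [V [Psi [s [Up diff s0 st]]]]] : exists U V Psi (s : R),
    [/\ U p, diffeo U V Phi Psi, s != 0 &
      \forall t \near 0^'+, U (Psi (Phi p + t *: (s *: 'D_v Phi p))) ->
        Phi (Psi (Phi p + t *: (s *: 'D_v Phi p))) = Phi p + t *: (s *: 'D_v Phi p) ->
        Sigma (Psi (Phi p + t *: (s *: 'D_v Phi p)))].
  pose c (t : R) := Phi p + t *: (s *: 'D_v Phi p).
  have c0 : c 0 = Phi p by rewrite /c scale0r addr0.
  have dc : differentiable c 0.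
    by apply: differentiableD => //; apply: differentiableZl.
  have [[oU oV] [sPhi sPsi] UV VU] := diff.
  have dPsi : differentiable Psi (c 0).
    by rewrite c0; exact: smooth_differentiable sPsi (UV p Up).1.
  exists (Psi \o c), s; split => //.
  - exact: differentiable_comp.
  - by rewrite /= c0; exact: (UV p Up).2.
  - have Dc : 'D_1 c 0 = s *: 'D_v Phi p.
      exact: derive_line.
    rewrite deriveE; last exact: differentiable_comp.
    rewrite diff_comp//= -[X in 'd Psi _ X]deriveE// Dc c0 linearZ/=.
    by rewrite deriveE// (diffeo_diffK _ _ _ _ _ _ diff Up).
  - have Vc : \forall t \near (0 : R)^'+, V (c t).
      have cc : c t @[t --> (0 : R)] --> c 0 := differentiable_continuous dc.
      apply: (cvg_at_right_filter cc).
      by rewrite c0; apply: open_nbhs_nbhs; split=> //; exact: (UV p Up).1.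
    near=> t.
    have Vct : V (c t) by near: t.
    have [Ut PhiE] := VU _ Vct.
    by move: Ut PhiE; near: t; exact: st.
case: chart => [[U [V [Psi [Up diff flat]]]]|[i [_ [U [V [Psi [Up [_ pi0] diff flat]]]]]]].
  exists U, V, Psi, 1; split => //.
  have p0 : Phi p 0 ord_max = 0 by apply/flat.
  apply: nearW => t Ut PhiE; apply/flat => //.
  by rewrite PhiE !mxE p0 vlast !mulr0 addr0.
have [p0 _] : Phi p 0 ord_max = 0 /\ 0 <= Phi p 0 i by apply/flat.
pose s : R := if 0 <= ('D_v Phi p) 0 i then 1 else -1.
have s0 : s != 0 by rewrite /s; case: ifP; rewrite ?oppr_eq0 oner_neq0.
have si : 0 <= s * ('D_v Phi p) 0 i.
  rewrite /s; case: ifPn; rewrite ?mul1r// -ltNge mulN1r oppr_ge0; exact: ltW.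
exists U, V, Psi, s; split => //.
near=> t => Ut PhiE; apply/flat => //.
have t0 : 0 < t by near: t; exact: nbhs_right_gt.
by rewrite PhiE !mxE p0 vlast !mulr0 addr0 pi0 add0r mulr_ge0// ltW.
Unshelve. all: by end_near. Qed.

End Charts.

(** * Independence of the tangential operators from the chosen extension *)

Section TangentialCalculus.
Context {R : realType} {n : nat}.
Local Notation E := 'rV[R]_n.+1.
Implicit Types (Sigma U : set E) (p v w : E) (Phi X Y N : E -> E) (u : E -> R).

(** Along the curve of [flat_chart_curve], [Y] vanishes for small positive times, while the chain
    rule gives the derivative [s *: 'D_v Y p] at time 0; then [s != 0] is divided out. *)
Lemma flat_chart_derive0 (W : normedModType R) Sigma p Phi v (Y : E -> W) :
  Sigma p -> flat_chart Sigma p Phi -> ('D_v Phi p) 0 ord_max = 0 ->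
  differentiable Y p -> (\forall q \near p, Sigma q -> Y q = 0) -> 'D_v Y p = 0.
Proof.
move=> Sp chart vlast dY Y0.
have [c [s [s0 dc c0 Dc cS]]] := flat_chart_curve _ _ _ _ Sp chart vlast.
have dYc : differentiable Y (c 0) by rewrite c0.
have : 'D_1 (Y \o c) 0 = 0.
  apply: derive_eq0_right.
  - by apply: diff_derivable; exact: differentiable_comp.
  - by rewrite /= c0; exact: nbhs_singleton Y0 Sp.
  - have cc : c t @[t --> (0 : R)] --> c 0 := differentiable_continuous dc.
    have Yc : \forall t \near (0 : R)^'+, Sigma (c t) -> Y (c t) = 0.
      have Y0c : nbhs (c 0) [set q | Sigma q -> Y q = 0] by rewrite c0.
      exact: (cvg_at_right_filter cc) Y0c.
    by apply: filterS2 cS Yc => t St; apply.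
rewrite deriveE; last exact: differentiable_comp.
rewrite diff_comp//= -[X in 'd Y _ X]deriveE// Dc c0 linearZ/= -deriveE//.
by move=> /eqP; rewrite scaler_eq0 (negPf s0) => /eqP.
Qed.

(** [unit_normal] states that tangent vectors are orthogonal to [N p]. The converse holds because
    both spaces are kernels of linear forms, where [perp_kernel] reverses the inclusion. *)
Lemma normal_tangent_space Sigma N p Phi v : unit_normal Sigma N -> Sigma p ->
  flat_chart Sigma p Phi -> dot v (N p) = 0 -> ('D_v Phi p) 0 ord_max = 0.
Proof.
move=> [_ /(_ p)] NS Sp chart vN; have [N1 NT] := NS Sp.
have dPhi := flat_chart_differentiable _ _ _ chart.
(* The gradient at [p] of the last coordinate of [Phi]. *)
pose g : E := (col ord_max ('J Phi p))^T.
have gE w : dot g w = ('D_w Phi p) 0 ord_max.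
  by rewrite dotC dotE trmxK deriveEjacobian// colE mulmxA -colE mxE.
rewrite -gE; apply: (@perp_kernel _ _ _ (N p)) => [|w|]; last by rewrite dotC.
  apply/eqP => N0; have := enorm1_dot _ N1; rewrite N0 dot0l => /eqP.
  by rewrite eq_sym oner_eq0.
by rewrite gE => gw; apply: NT; exists Phi.
Qed.

Lemma tangent_derive0 (W : normedModType R) Sigma N p v (Y : E -> W) :
  hypersurface Sigma -> unit_normal Sigma N -> Sigma p -> dot v (N p) = 0 ->
  differentiable Y p -> (\forall q \near p, Sigma q -> Y q = 0) -> 'D_v Y p = 0.
Proof.
move=> hS hN Sp vN dY Y0.
have [Phi chart] : exists Phi, flat_chart Sigma p Phi.
  by have [[Phi c]|[i [Phi c]]] := hS p Sp; exists Phi; [left|right; exists i].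
apply: (flat_chart_derive0 _ _ _ _ _ _ Sp chart) => //.
exact: normal_tangent_space hN Sp chart vN.
Qed.

Lemma dot_grad u p v : differentiable u p -> dot (grad u p) v = 'D_v u p.
Proof.
move=> du; rewrite deriveE// [in RHS](row_sum_delta v) linear_sum.
by apply: eq_bigr => i _; rewrite mxE linearZ/= deriveE// mulrC.
Qed.

(** The projection is itself orthogonal to [N p], so it may be taken as [w]; this makes its own
    square zero. *)
Lemma tproj_eq0 N p v : dot (N p) (N p) = 1 ->
  (forall w, dot w (N p) = 0 -> dot v w = 0) -> tproj N p v = 0.
Proof.
move=> N1 v0; have tN : dot (tproj N p v) (N p) = 0.
  by rewrite dotBl dotZl N1 mulr1 subrr.
by apply: dot_eq0; rewrite {1}/tproj dotBl v0// dotZl [dot (N p) _]dotC tN mulr0 subr0.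
Qed.

Lemma tprojB N p v w : tproj N p (v - w) = tproj N p v - tproj N p w.
Proof. by rewrite /tproj dotBl scalerBl !opprD !opprK addrACA. Qed.

(** Vectors are rows, so a matrix acts on the right. The left-hand side is the trace of [P *m A],
    where [P] projects onto the orthogonal complement of [e]; the rows of [P] lie in that complement
    and are killed by [A]. *)
Lemma trace_perp_eq0 (A : 'M[R]_n.+1) (e : E) : dot e e = 1 ->
  (forall v, dot v e = 0 -> v *m A = 0) -> \tr A - dot (e *m A) e = 0.
Proof.
move=> e1 A0; pose P : 'M[R]_n.+1 := 1%:M - e^T *m e.
have PA : P *m A = 0.
  apply/row_matrixP => i; rewrite row_mul row0; apply: A0.
  rewrite dotE -row_mul mulmxBl mul1mx -mulmxA.
  by rewrite mul_tr_dot e1 mulmx1 subrr !mxE.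
rewrite -[X in _ - X](_ : \tr (e *m A *m e^T) = _); last first.
  by rewrite mul_tr_dot mxtrace_scalar mulr1n.
rewrite mxtrace_mulC mulmxA -raddfB -[X in X - _]mul1mx -mulmxBl PA.
exact: raddf0.
Qed.

Lemma derive_sub_jacobian X Y p v : differentiable X p -> differentiable Y p ->
  'D_v (X - Y) p = v *m ('J X p - 'J Y p).
Proof.
move=> dX dY; rewrite mulmxBr.
rewrite (deriveB (diff_derivable dX) (diff_derivable dY)).
by rewrite !deriveEjacobian.
Qed.

(** Two extensions differ by a field vanishing on [Sigma] near [p], whose Jacobian kills every [v]
    orthogonal to [N p]; [trace_perp_eq0] then equates the two tangential traces. *)
Lemma divSE Sigma N X p Y : hypersurface Sigma -> unit_normal Sigma N ->
  Sigma p -> local_ext 1 Sigma X p Y ->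
  divS Sigma N X p = \tr ('J Y p) - dot ('D_(N p) Y p) (N p).
Proof.
move=> hS hN Sp XY.
have := xgetPex X (ex_intro _ _ XY); rewrite -/(ext Sigma X p) /divS /=.
move: (ext Sigma X p) => Z [U [oU Up CZ ZX]].
have [V [oV Vp CY YX]] := XY.
have dZ : differentiable Z p := CZ.1 p Up.
have dY : differentiable Y p := CY.1 p Vp.
apply/eqP; rewrite -subr_eq0; apply/eqP.
have N1 := enorm1_dot _ (hN.2 p Sp).1.
have := trace_perp_eq0 ('J Z p - 'J Y p) (N p) N1.
rewrite raddfB/= mulmxBr dotBl !deriveEjacobian// => <-.
  by rewrite !opprD !opprK addrACA.
move=> v vN.
rewrite -derive_sub_jacobian//.
apply: (tangent_derive0 _ _ _ _ _ _ hS hN Sp vN).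
  exact: differentiableB.
have UV : nbhs p (U `&` V).
  by apply: filterI; apply: open_nbhs_nbhs.
apply: filterS UV => q [Uq Vq] Sq; rewrite -[LHS]/(Z q - Y q).
by rewrite (ZX _ (conj Uq Sq)) (YX _ (conj Vq Sq)) subrr.
Qed.

Lemma gradSE Sigma N u p : hypersurface Sigma -> unit_normal Sigma N ->
  Sigma p -> differentiable u p ->
  gradS Sigma N u p = tproj N p (grad u p).
Proof.
move=> hS hN Sp du; rewrite /gradS.
(* Differentiability at [p] does not provide a local C^1 extension; without one, [ext] falls back on
   [u] itself. *)
have [ex|nex] := pselect (exists f, local_ext 1 Sigma u p f); last first.
  rewrite /ext xgetPN// => f uf; apply: nex; exists f; exact: uf.
have := xgetPex u ex; rewrite -/(ext Sigma u p).
move: (ext Sigma u p) => w [U [oU Up Cw wu]].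
have dw : differentiable w p := Cw.1 p Up.
apply/eqP; rewrite -subr_eq0 -tprojB; apply/eqP.
apply: tproj_eq0 => [|v vN]; first exact: enorm1_dot _ (hN.2 p Sp).1.
rewrite dotBl !dot_grad//.
rewrite -(deriveB (diff_derivable dw) (diff_derivable du)).
apply: (tangent_derive0 _ _ _ _ _ _ hS hN Sp vN).
  exact: differentiableB.
apply: filterS (open_nbhs_nbhs (conj oU Up)) => q Uq Sq.
by rewrite -[LHS]/(w q - u q) (wu _ (conj Uq Sq)) subrr.
Qed.

End TangentialCalculus.

(** * Differentiability and monotonicity of a radial weight *)

Section Radial.
Context {R : realType} {n : nat}.
Local Notation E := 'rV[R]_n.+1.
Implicit Types (p v : E) (delta ddelta : R -> R).

Lemma is_derive_comp1 (f : E -> R) (g : R -> R) (dg : R) p v :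
  differentiable f p -> is_derive (f p) 1 g dg ->
  differentiable (g \o f) p /\ 'D_v (g \o f) p = 'D_v f p * dg.
Proof.
move=> df [dfg gE]; have dgp : differentiable g (f p) by exact/derivable1_diffP.
have dgf : differentiable (g \o f) p by exact: differentiable_comp.
split=> //; rewrite deriveE// diff_comp//= deriv1E//.
by rewrite derive1E gE -deriveE.
Qed.

Lemma is_derive_enorm p v : p != 0 ->
  differentiable (@enorm R n) p /\ 'D_v (@enorm R n) p = dot p v / enorm p.
Proof.
move=> p0; have p_gt0 : 0 < dot p p.
  by rewrite lt_neqAle dot_ge0 andbT eq_sym; apply: contra_neq p0 => /dot_eq0.
have [dd Dd] : differentiable (fun x : E => dot x x) p /\
    'D_v (fun x : E => dot x x) p = dot v p + dot p v.
  have did : differentiable (id : E -> E) p by [].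
  by have := is_derive_dot id id p v did did; rewrite derive_id.
have [de De] := is_derive_comp1 _ _ _ _ v dd (is_derive1_sqrt p_gt0).
split; first exact: de.
rewrite -[LHS]/('D_v (Num.sqrt \o (fun x : E => dot x x)) p) De Dd.
by rewrite (dotC v) -mulr2n -(mulr_natl (dot p v)) invfM mulrACA divff ?mul1r// pnatr_eq0.
Qed.

(** Each squared coordinate is at most the squared sup norm. The bound converts estimates in the
    Euclidean norm into the little-o of the sup norm that defines differentiability. *)
Lemma enorm_le p : enorm p <= Num.sqrt n.+1%:R * `|p|.
Proof.
have pn : 0 <= `|p| by exact: normr_ge0.
rewrite -[leRHS]ger0_norm ?mulr_ge0 ?sqrtr_ge0// -sqrtr_sqr ler_sqrt ?sqr_ge0//.
rewrite exprMn sqr_sqrtr ?ler0n// -[X in X%:R * _](card_ord n.+1) mulr_natl -sumr_const.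
apply: ler_sum => i _; rewrite -expr2 -real_normK ?num_real//.
rewrite ler_pXn2r ?nnegrE ?normr_ge0// [leRHS]/Num.norm /= mx_normrE.
exact: (le_bigmax _ (fun ij : 'I_1 * 'I_n.+1 => `|p ij.1 ij.2|) (0, i)).
Qed.

Lemma radial_diff0 delta ddelta : C1_halfline delta ddelta -> ddelta 0 = 0 ->
  differentiable (radial delta) (0 : E) /\ forall v, 'D_v (radial delta) (0 : E) = 0.
Proof.
move=> [_ d0 _] dd0; rewrite dd0 in d0.
have e0 : enorm (0 : E) = 0 by rewrite /enorm dot0l sqrtr0.
pose s : R := Num.sqrt n.+1%:R.
have s0 : 0 < s by rewrite sqrtr_gt0 ltr0n.
have o0 : radial delta \o shift (0 : E) = cst (radial delta (0 : E)) + 0 +o_ (0 : E) id.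
  apply/eqaddoP => _/posnumP[e].
  (* Dividing by [s] compensates for the factor lost in [enorm_le]; the radius [r / s] below does
     the same. *)
  have es : 0 < e%:num / s by rewrite divr_gt0.
  have /cvgrPdist_le/(_ _ es) := d0.
  move=> [r /= r0 hr].
  have rs : \forall x \near (0 : E), `|x| < r / s by apply: nbhs0_lt; rewrite divr_gt0.
  near=> x.
  rewrite /= !fctE addr0.
  have xs : s * `|x| < r.
    by rewrite mulrC -ltr_pdivlMr//; near: x.
  have ex : enorm x <= s * `|x| := enorm_le x.
  rewrite /radial e0 /= addr0.
  have [-> |x0] := eqVneq (enorm x) 0; first by rewrite subrr normr0 mulr_ge0.
  have x_gt0 : 0 < enorm x by rewrite lt_neqAle eq_sym x0 enorm_ge0.
  have := hr (enorm x); rewrite /= !sub0r !normrN gtr0_norm// => /(_ (le_lt_trans ex xs) x_gt0).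
  rewrite normrM gtr0_norm ?invr_gt0// mulrC ler_pdivrMr// => /le_trans; apply.
  by rewrite -mulrA ler_pM2l// mulrC ler_pdivrMr// mulrC.
have d00 : 'd (radial delta) (0 : E) = 0 :> (E -> R).
  by apply/diff_unique => //; exact: cst_continuous.
have dr : differentiable (radial delta) (0 : E).
  by apply/diff_locallyP; rewrite d00; split=> //; exact: cst_continuous.
by split=> // v; rewrite deriveE// d00.
Unshelve. all: by end_near. Qed.

(* At p = 0 the formula reads 0, since x / 0 = 0 and dot 0 v = 0. *)
Lemma is_derive_radial delta ddelta p v : C1_halfline delta ddelta -> ddelta 0 = 0 ->
  differentiable (radial delta) p /\
  'D_v (radial delta) p = ddelta (enorm p) / enorm p * dot p v.
Proof.
move=> dC dd0; have [->|p0] := eqVneq p 0.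
  by have [? ->] := radial_diff0 _ _ dC dd0; rewrite dot0l mulr0.
have [de De] := is_derive_enorm p v p0.
have ep : 0 < enorm p.
  by rewrite lt_neqAle enorm_ge0 andbT eq_sym; apply: contra_neq p0 => /enorm_eq0.
have [dr Dr] := is_derive_comp1 _ _ _ _ v de (let: And3 h _ _ := dC in h _ ep).
split; first exact: dr.
rewrite -[LHS]/('D_v (delta \o @enorm R n) p) Dr De.
by rewrite mulrC mulrCA mulrC.
Qed.

Lemma nonincreasing_derive_le0 delta ddelta t : C1_halfline delta ddelta ->
  nonincreasing_halfline delta -> 0 < t -> ddelta t <= 0.
Proof.
move=> [/(_ t) dd _ _] noninc t0; have [dt <-] := dd t0.
apply: limr_le => //; near=> h.
have h0 : h != 0 by near: h; exact: nbhs_dnbhs_neq.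
(* This keeps [h + t] in the half-line on which monotonicity is assumed. *)
have hn : `|h| < t by near: h; exact: dnbhs0_lt.
have ht : 0 <= h + t by rewrite -lerBlDr sub0r ltW// ltrNl; case/ltr_normlP: hn.
rewrite /= [h *: 1]mulr1.
move: h0; rewrite neq_lt => /orP[h0|h0].
- rewrite nmulr_rle0 ?invr_lt0// subr_ge0 noninc// gerDr; exact: ltW.
- rewrite pmulr_rle0 ?invr_gt0// subr_le0 noninc// ?lerDr; exact: ltW.
Unshelve. all: by end_near. Qed.

End Radial.

(** * Weighted Laplacian of the height function *)

Section WeightedLaplacian.
Context {R : realType} {n : nat}.
Local Notation E := 'rV[R]_n.+1.
Implicit Types (Sigma U : set E) (p v eta : E) (N : E -> E).

Lemma Ck_cst (W : normedModType R) k U (a : W) : Ck k U (fun _ : E => a).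
Proof.
elim: k a => [a x _|k IH a]; first exact: cst_continuous.
split=> [x _|v]; first exact: differentiable_cst.
have -> : (fun x : E => 'D_v (fun _ : E => a) x) = fun _ => 0.
  by apply/funext => x; exact: derive_cst.
exact: IH.
Qed.

Lemma is_derive_dotr eta p v : differentiable (fun x : E => dot x eta) p /\
  'D_v (fun x : E => dot x eta) p = dot v eta.
Proof.
have did : differentiable (id : E -> E) p by [].
have := is_derive_dot id (fun _ : E => eta) p v did (differentiable_cst eta p).
by rewrite derive_id derive_cst dot0r addr0.
Qed.

Lemma Ck_dot k U eta : Ck k U (fun x : E => dot x eta).
Proof.
case: k => [x _|k].
  exact: differentiable_continuous (is_derive_dotr eta x 0).1.
split=> [x _|v]; first exact: (is_derive_dotr eta x 0).1.
have -> : (fun x : E => 'D_v (fun y : E => dot y eta) x) = fun _ => dot v eta.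
  by apply/funext => x; exact: (is_derive_dotr eta x v).2.
exact: Ck_cst.
Qed.

Lemma grad_dot eta p : grad (fun x : E => dot x eta) p = eta.
Proof.
by apply/rowP => i; rewrite mxE (is_derive_dotr eta p _).2 dotC dot_delta.
Qed.

Lemma is_derive_tangent_part eta (Y : E -> E) p v : differentiable Y p ->
  differentiable (fun x => eta - dot (Y x) eta *: Y x) p /\
  'D_v (fun x => eta - dot (Y x) eta *: Y x) p =
    - (dot ('D_v Y p) eta *: Y p + dot (Y p) eta *: 'D_v Y p).
Proof.
move=> dY.
have [dk Dk] := is_derive_dot Y (fun _ : E => eta) p v dY (differentiable_cst eta p).
have [dkY DkY] := is_derive_scale _ _ _ v dk dY.
have deta : differentiable (fun _ : E => eta) p := differentiable_cst eta p.
split; first exact: differentiableB deta dkY.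
rewrite (deriveB (diff_derivable deta) (diff_derivable dkY)) DkY Dk.
by rewrite !derive_cst dot0r addr0 sub0r.
Qed.

(** When [Y] extends the unit normal, this field extends the tangential part of [eta], which is the
    tangential gradient of the height; [lapS_dot] needs it to be C^1. *)
Lemma Ck1_tangent_part eta U (Y : E -> E) : open U -> Ck 1 U Y ->
  Ck 1 U (fun x => eta - dot (Y x) eta *: Y x).
Proof.
move=> oU [dY cDY]; split=> [x Ux|v x Ux].
  by have [] := is_derive_tangent_part eta Y x 0 (dY x Ux).
have cY : Y @ x --> Y x := differentiable_continuous (dY x Ux).
have cD : 'D_v Y @ x --> 'D_v Y x := cDY v x Ux.
have cdot (f : E -> E) : f @ x --> f x -> dot (f y) eta @[y --> x] --> dot (f x) eta.
  move=> cf.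
  have ce := differentiable_continuous (is_derive_dotr eta (f x) 0).1.
  exact: (continuous_comp cf ce).
have c : - (dot ('D_v Y y) eta *: Y y + dot (Y y) eta *: 'D_v Y y) @[y --> x] -->
    - (dot ('D_v Y x) eta *: Y x + dot (Y x) eta *: 'D_v Y x).
  exact: cvgN (cvgD (cvgZ (cdot _ cD) cY) (cvgZ (cdot _ cY) cD)).
pose Z : E -> E := fun y => eta - dot (Y y) eta *: Y y.
have ZE y : U y -> 'D_v Z y = - (dot ('D_v Y y) eta *: Y y + dot (Y y) eta *: 'D_v Y y).
  by move=> Uy; exact: (is_derive_tangent_part eta Y y v (dY y Uy)).2.
(* The explicit formula for the derivative holds on [U] only, which suffices for a limit at [x]
   since [U] is open. *)
have : 'D_v Z @ x --> 'D_v Z x.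
  rewrite ZE//; apply: (cvg_trans _ c); apply: (@near_eq_cvg _ _ (nbhs x)).
  have : nbhs x U := open_nbhs_nbhs (conj oU Ux).
  by apply: (@filterS _ (nbhs x)) => y Uy; rewrite ZE.
exact.
Qed.


Lemma gradS_dot Sigma N eta p : hypersurface Sigma -> unit_normal Sigma N ->
  Sigma p -> gradS Sigma N (fun x => dot x eta) p = tproj N p eta.
Proof.
move=> hS hN Sp; rewrite gradSE// ?grad_dot//; exact: (is_derive_dotr eta p 0).1.
Qed.

(* The tangential trace of v |-> <D_v N, eta> N vanishes, its values being normal. *)
Lemma lapS_dot Sigma N eta p : hypersurface Sigma -> unit_normal Sigma N ->
  Sigma p -> lapS Sigma N (fun x => dot x eta) p = - (dot (N p) eta * divS Sigma N N p).
Proof.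
move=> hS hN Sp.
have [Y XY] := hN.1 1%N p Sp.
rewrite (divSE _ _ _ _ _ hS hN Sp XY).
have [U [oU Up CY YN]] := XY.
have Yp : Y p = N p by apply: YN.
pose Z : E -> E := fun x => eta - dot (Y x) eta *: Y x.
have XZ : local_ext 1 Sigma (gradS Sigma N (fun x => dot x eta)) p Z.
  exists U; split; [exact: oU|exact: Up|exact: Ck1_tangent_part oU CY|].
  move=> q [Uq Sq]; have Yq : Y q = N q by exact: YN.
  by rewrite gradS_dot// /Z Yq /tproj (dotC eta).
rewrite /lapS (divSE _ _ _ _ _ hS hN Sp XZ).
have dY : differentiable Y p := CY.1 p Up.
have [dZ _] : differentiable Z p /\ _ := is_derive_tangent_part eta Y p 0 dY.
have DZ v : 'D_v Z p = - (dot ('D_v Y p) eta *: Y p + dot (Y p) eta *: 'D_v Y p).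
  exact: (is_derive_tangent_part eta Y p v dY).2.
have N1 := enorm1_dot _ (hN.2 p Sp).1.
pose A := 'J Y p.
have JZ : 'J Z p = - (A *m eta^T *m N p + dot (N p) eta *: A).
  apply/row_matrixP => i; rewrite !rowE -(deriveEjacobian (delta_mx 0 i) dZ).
  rewrite DZ (deriveEjacobian _ dY) Yp.
  rewrite mulmxN mulmxDr -scalemxAr !mulmxA -/A.
  by rewrite mul_tr_dot mul_scalar_mx.
rewrite (deriveEjacobian _ dZ) (deriveEjacobian _ dY) JZ -/A mulmxN mulmxDr -scalemxAr !mulmxA.
rewrite raddfN raddfD/= mxtraceZ dotNl dotDl dotZl.
rewrite mul_tr_dot mul_scalar_mx dotZl N1 mulr1.
have -> : \tr (A *m eta^T *m N p) = dot (N p *m A) eta.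
  by rewrite mxtrace_mulC mulmxA mul_tr_dot mxtrace_scalar mulr1n.
by ring.
Qed.

(** Minimality replaces the divergence of [N] in [lapS_dot] by minus the normal derivative of [psi].
    The Laplacian thus gives the normal part of the product of [grad psi p] with [eta], and the
    drift term gives the tangential part. *)
Lemma wlapS_dot Sigma N psi eta p : hypersurface Sigma -> unit_normal Sigma N ->
  wminimal Sigma N psi -> Sigma p -> differentiable psi p ->
  wlapS Sigma N psi (fun x => dot x eta) p = 'D_eta psi p.
Proof.
move=> hS hN hmin Sp dpsi; rewrite /wlapS lapS_dot// gradS_dot// gradSE//.
have N1 := enorm1_dot _ (hN.2 p Sp).1.
have /eqP := hmin p Sp.
rewrite /wmean_curv -opprD oppr_eq0 addr_eq0 => /eqP ->.
rewrite -dot_grad// /tproj !(dotBl, dotBr, dotZl, dotZr) N1 (dotC eta).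
by ring.
Qed.

(** By [divSE] the divergence may be computed with the zero field, which extends the gradient from
    [Sigma]. *)
Lemma wlapS_eq0 Sigma N psi u p : hypersurface Sigma -> unit_normal Sigma N ->
  Sigma p -> (forall q, Sigma q -> gradS Sigma N u q = 0) ->
  wlapS Sigma N psi u p = 0.
Proof.
move=> hS hN Sp u0; rewrite /wlapS u0// dot0r addr0 /lapS.
rewrite (divSE _ _ _ _ (fun _ => 0) hS hN Sp); last first.
  exists setT; split => //; [exact: openT | exact: Ck_cst | by move=> q [_ Sq]; rewrite u0].
rewrite derive_cst dot0l subr0 /jacobian diff_cst.
by rewrite [X in \tr X](_ : _ = 0) ?raddf0//; apply/matrixP => i j; rewrite !mxE.
Qed.

Lemma gradS_cst Sigma N u d p : hypersurface Sigma -> unit_normal Sigma N ->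
  differentiable u p -> (forall q, Sigma q -> u q = d) -> Sigma p ->
  gradS Sigma N u p = 0.
Proof.
move=> hS hN du ud Sp; rewrite gradSE//.
have dd : differentiable (fun _ : E => d) p := differentiable_cst d p.
apply: tproj_eq0 => [|v vN]; first exact: enorm1_dot _ (hN.2 p Sp).1.
rewrite dot_grad//.
have <- : 'D_v (u - (fun _ => d)) p = 'D_v u p.
  by rewrite (deriveB (diff_derivable du) (diff_derivable dd)) derive_cst subr0.
apply: (tangent_derive0 _ _ _ _ _ _ hS hN Sp vN); first exact: differentiableB.
by apply: filterE => q Sq; rewrite -[LHS]/(u q - d) ud// subrr.
Qed.

End WeightedLaplacian.

(** * Radial functions on connected sets *)

Lemma enorm_continuous (R : realType) (n : nat) : continuous (@enorm R n).
Proof.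
move=> x; apply: (@continuous_comp _ _ _ (fun y : 'rV[R]_n.+1 => dot y y) Num.sqrt).
  have did : differentiable (id : 'rV[R]_n.+1 -> 'rV[R]_n.+1) x by [].
  exact: differentiable_continuous (is_derive_dot id id x 0 did did).1.
exact: sqrt_continuous.
Qed.

Lemma halfline_constant (R : realType) (delta ddelta : R -> R) (a b : R) :
  C1_halfline delta ddelta -> 0 < a -> a <= b ->
  (forall t, a <= t <= b -> ddelta t = 0) -> delta a = delta b.
Proof.
move=> [dd _ _] a0 ab dd0.
have dd_itv t : t \in `[a, b]%R -> is_derive t 1 delta (ddelta t).
  by rewrite in_itv/= => /andP[at_ _]; apply: dd; exact: lt_le_trans a0 at_.
have delta_cont : {within `[a, b], continuous delta}.
  by apply: derivable_within_continuous => t /dd_itv [].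
have dd_oo t : t \in `]a, b[%R -> is_derive t 1 delta (ddelta t).
  by move=> t_itv; apply: dd_itv; exact: subset_itv_oo_cc t_itv.
have [t t_itv] := MVT_segment ab dd_oo delta_cont.
rewrite dd0 ?mul0r; last by move: t_itv; rewrite in_itv.
by move=> /eqP; rewrite subr_eq0 => /eqP.
Qed.

(** The norms of points of [A] form an interval, so every value between two of them is again such a
    norm and [ddelta] vanishes there; the mean value theorem concludes. *)
Lemma radial_constant_on (R : realType) (n : nat) (delta ddelta : R -> R)
    (A : set 'rV[R]_n.+1) :
  C1_halfline delta ddelta -> connected A ->
  (forall q, A q -> 0 < enorm q /\ ddelta (enorm q) = 0) ->
  constant_on A (radial delta).
Proof.
move=> delta_C1 A_conn A0.
have /connected_intervalP itvA : connected (@enorm R n @` A).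
  apply: connected_continuous_connected => //.
  exact/continuous_subspaceT/enorm_continuous.
suff le_case p q : A p -> A q -> enorm p <= enorm q -> radial delta p = radial delta q.
  have [A_empty|/set0P[p Ap]] := eqVneq A set0.
    by exists 0; rewrite A_empty.
  exists (radial delta p) => q Aq.
  have [pq|/ltW qp] := leP (enorm p) (enorm q); last exact: le_case.
  by apply/esym; exact: le_case.
move=> Ap Aq pq.
apply: (halfline_constant _ _ _ _ _ delta_C1 (A0 p Ap).1 pq) => t t_itv.
have [r Ar <-] : (@enorm R n @` A) t by apply: itvA t_itv; [exists p|exists q].
exact: (A0 r Ar).2.
Qed.

(** * Parabolicity applied to the height function *)

Theorem proposition3p11 (R : realType) (n : nat) (delta ddelta : R -> R)
    (Sigma : set 'rV[R]_n.+1) (N nu : 'rV[R]_n.+1 -> 'rV[R]_n.+1)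
    (eta : 'rV[R]_n.+1) (c : R)
    (delta_C1 : C1_halfline delta ddelta)
    (delta_nonincr : nonincreasing_halfline delta)
    (ddelta0 : ddelta 0 = 0)
    (hSigma : hypersurface Sigma)
    (hN : unit_normal Sigma N)
    (hnu : inner_conormal Sigma nu)
    (Sigma_conn : connected Sigma)
    (Sigma_parab : wparabolic Sigma N nu (radial delta))
    (Sigma_min : wminimal Sigma N (radial delta))
    (eta_unit : enorm eta = 1)
    (F0 : hyperplane eta c 0)
    (Sigma_F : Sigma `<=` half_space eta c)
    (eta_nu : forall p, bdry Sigma p -> 0 <= dot eta (nu p)) :
  (exists d : R, Sigma `<=` hyperplane eta d) /\
  (~ constant_on Sigma (radial delta) -> Sigma `<=` hyperplane eta c).
Proof.
have c0 : c = 0 by rewrite -F0 dot0l.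
have wlap p : Sigma p -> wlapS Sigma N (radial delta) (fun x => dot x eta) p =
    ddelta (enorm p) / enorm p * dot p eta.
  move=> Sp; have [dpsi <-] := is_derive_radial _ _ p eta delta_C1 ddelta0.
  exact: wlapS_dot.
have [d ud] : constant_on Sigma (fun x => dot x eta).
  apply: Sigma_parab.
  - move=> p Sp; exists (fun x => dot x eta), setT.
    by split => //; [exact: openT | exact: Ck_dot].
  - by exists c => p /Sigma_F.
  - move=> p [Sp _]; rewrite wlap//.
    have u_le0 : dot p eta <= 0 by rewrite -c0; exact: Sigma_F.
    have dd_le0 : ddelta (enorm p) <= 0.
      (* [Sigma] may pass through the origin, where the sign comes from [ddelta0], monotonicity
         being used at positive radii. *)
      have := enorm_ge0 p; rewrite le_eqVlt => /predU1P[<-|]; first by rewrite ddelta0.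
      exact: nonincreasing_derive_le0 delta_C1 delta_nonincr.
    by rewrite mulr_le0// mulr_le0_ge0// invr_ge0 enorm_ge0.
  - move=> p bp; have [i [Phi [chart _ nuT _ _]]] := hnu p bp.
    have Sp : Sigma p by have [_ [U [V [Psi [_ [] ]]]]] := chart.
    (* The conormal is tangent to [Sigma], so projecting [eta] does not change its product with
       [nu p]. *)
    have Nnu : dot (N p) (nu p) = 0.
      by apply: (hN.2 p Sp).2; exists Phi; split => //; right; exists i.
    by rewrite gradS_dot// dotBl dotZl Nnu mulr0 subr0 eta_nu.
split; first by exists d.
move=> nonconst p Sp; rewrite c0.
have [d0|d0] := eqVneq d 0; first by rewrite -d0; exact: ud.
exfalso; apply: nonconst; apply: radial_constant_on delta_C1 Sigma_conn _ => q Sq.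
(* A nonzero height [d] keeps [Sigma] away from the origin. *)
have q_gt0 : 0 < enorm q.
  rewrite lt_neqAle enorm_ge0 andbT; apply/eqP => /esym/enorm_eq0 q0.
  by move: (ud q Sq) d0; rewrite q0 dot0l => <-; rewrite eqxx.
(* The weighted Laplacian is evaluated twice: it is 0 since the height is constant on [Sigma], and
   it is [ddelta (enorm q) / enorm q * d] by [wlap]. *)
split=> //; have := wlap q Sq; rewrite wlapS_eq0//; last first.
  move=> r Sr; apply: gradS_cst hSigma hN _ ud Sr.
  exact: (is_derive_dotr eta r 0).1.
rewrite ud// => /esym/eqP.
by rewrite !mulf_eq0 (negPf d0) invr_eq0 (gt_eqF q_gt0) !orbF => /eqP.
Qed.
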